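(* For every integer $n \ge 3$, the optimal pegging number of the path $P_n$ on $n$ vertices is $p(P_n)=\lceil n/2\rceil$.
   Context: $P_n$ is the path on $n$ vertices. A distribution of pegs on a graph $G$ is a subset $D \subseteq V(G)$. If $u,v \in D$ are distinct adjacent vertices and $w \notin D$ is a vertex adjacent to $v$, the pegging move (jumping $u$ over $v$ into $w$) replaces $D$ by $(D\setminus\{u,v\})\cup\{w\}$. A vertex $t$ is reachable from $D$ if some finite (possibly empty) sequence of pegging moves starting from $D$ ends in a distribution containing $t$; $\mathrm{Reach}(D)$ is the set of reachable vertices. The optimal pegging number $p(G)$ is the smallest positive integer $d$ such that some distribution of size $d$ on $G$ has reach $V(G)$. *)

(* Defs.v *)
From mathcomp Require Import all_boot.

Set Implicit Arguments.
Unset Strict Implicit.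
Unset Printing Implicit Defensive.

Record sgraph := SGraph {
  vertex :> finType;
  adj : rel vertex;
  adj_sym : symmetric adj;
  adj_irr : irreflexive adj
}.

Section Pegging.
Variable G : sgraph.
Implicit Types (D : {set G}) (d : nat).

(* The vertices [u] and [v] are distinct because [adj] is irreflexive. *)
Definition pegging_move : rel {set G} := fun D D' =>
  [exists u, exists v, exists w,
    [&& u \in D, v \in D, adj u v, w \notin D, adj v w
      & D' == w |: (D :\: [set u; v])]].

(* [connect] is the reflexive transitive closure. *)
Definition reach D : {set G} :=
  [set t | [exists D' : {set G}, connect pegging_move D D' && (t \in D')]].

Definition full_reach_size d : bool :=
  (0 < d) && [exists D : {set G}, (#|D| == d) && (reach D == [set: G])].

(* A distribution has at most [#|G|] pegs, so the minimum may be taken over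
   'I_#|G|.+1. The value is meaningful only when [G] has a vertex; see
   [optimal_pegging_numberP]. *)
Definition optimal_pegging_number : nat :=
  [arg min_(d < (ord_max : 'I_(#|G|.+1)) | full_reach_size d) (d : nat)].

Lemma sub_reach D : D \subset reach D.
Proof.
by apply/subsetP => x xD; rewrite inE; apply/existsP; exists D; rewrite connect0.
Qed.

Lemma optimal_pegging_numberP : 0 < #|G| ->
  full_reach_size optimal_pegging_number /\
  forall d, full_reach_size d -> optimal_pegging_number <= d.
Proof.
move=> G_gt0; rewrite /optimal_pegging_number; case: arg_minnP => [|d Pd min_d].
  rewrite /full_reach_size /= G_gt0 /=; apply/existsP; exists [set: G].
  by rewrite cardsT eqxx eqEsubset subsetT sub_reach.
split=> // k Pk; have /andP[_ /existsP[D /andP[/eqP DE _]]] := Pk.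
have k_lt : k < #|G|.+1 by rewrite -DE ltnS max_card.
exact: (min_d (Ordinal k_lt)).
Qed.

End Pegging.

Definition path_adj n : rel 'I_n := fun i j => (i.+1 == j) || (j.+1 == i).

Lemma path_adj_sym n : symmetric (@path_adj n).
Proof. by move=> i j; rewrite /path_adj orbC. Qed.

Lemma path_adj_irr n : irreflexive (@path_adj n).
Proof. by move=> i; rewrite /path_adj orbb eqn_leq ltnn. Qed.

Definition path_graph n : sgraph := SGraph (@path_adj_sym n) (@path_adj_irr n).

(* Main.v *)
Require Import Defs.
From mathcomp Require Import all_boot.
From mathcomp Require Import zify.

Set Implicit Arguments.
Unset Strict Implicit.
Unset Printing Implicit Defensive.

(** Upper bound: numbering the vertices from 0, the pegs at 1, 2, 4, 6, ...
    reach 0 by one jump to the left, and every odd vertex by jumping 1 over 2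
    into 3, then 3 over 4 into 5, and so on.

    Lower bound: give vertex [x] the weight [fib x.+1]. As long as [t] is empty,
    the pegs on its left do not interact with those on its right, and no jump
    increases the total weight of the pegs left of [t]. If [t] is reached from
    the left, that weight is therefore at least [fib t.+1]; call [t] left-heavy
    in this case, and right-heavy in the mirrored case. Since
    [fib 1 + ... + fib m < fib m.+2], a left-heavy vertex has a peg immediately
    to its left, and a right-heavy one has a peg immediately to its right. Send
    an empty vertex to its left neighbour if it is left-heavy, and to its right
    neighbour otherwise. This map is injective: if [p] is a peg, [p-1] is empty
    and [p+1] is left-heavy, then the recurrence of [fib] shows that [p-1] is
    left-heavy too. So at most half of the vertices are empty. *)

Fixpoint fib n :=
  if n is m.+1 then (if m is k.+1 then fib k + fib m else 1) else 0.

Arguments fib : simpl never.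

Lemma fibSS n : fib n.+2 = fib n + fib n.+1.
Proof. by []. Qed.

Lemma fib_gt0 n : 0 < fib n.+1.
Proof. by elim: n => // n IHn; rewrite fibSS addn_gt0 IHn orbT. Qed.

Lemma sum_fib_lt n t : \sum_(i < n | i.+1 < t) fib i.+1 < fib t.+1.
Proof.
(* The bound has to grow with [n] for the induction: while [n.+1 < t], the new term raises it by the
   Fibonacci recurrence; afterwards neither side changes. *)
suff: \sum_(i < n | i.+1 < t) fib i.+1 < fib (minn n.+1 t).+1.
  have fib_homo i j : i <= j -> fib i.+1 <= fib j.+1.
    elim: j => [|j IHj]; first by rewrite leqn0 => /eqP->.
    rewrite leq_eqVlt => /predU1P[-> // | /IHj /leq_trans-> //].
    by rewrite fibSS leq_addl.
  by move/leq_trans; apply; apply: fib_homo; apply: geq_minr.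
elim: n => [|n IHn]; first by rewrite big_ord0 fib_gt0.
rewrite big_mkcond big_ord_recr -big_mkcond /=.
case: ifP => ltnt.
  have -> : minn n.+2 t = n.+2 by lia.
  have En : minn n.+1 t = n.+1 by lia.
  by rewrite (fibSS n.+1) addnC -addnS leq_add2l -[in leqRHS]En.
have -> : minn n.+2 t = minn n.+1 t by lia.
by rewrite addn0.
Qed.

Section Weight.
Variables (G : sgraph) (c : G -> nat).
Implicit Types D : {set G}.

Definition weight D := \sum_(x in D) c x.

Lemma weight_move D u v w : u \in D -> v \in D -> u != v -> w \notin D ->
  weight (w |: (D :\: [set u; v])) + (c u + c v) = weight D + c w.
Proof.
move=> uD vD neq_uv wD; rewrite /weight big_setU1 ?inE ?(negPf wD) ?andbF //=.
have sub : [set u; v] \subset D by rewrite subUset !sub1set uD.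
rewrite [in RHS](big_setID [set u; v]) /= (setIidPr sub).
by rewrite [\sum_(x in [set u; v]) _]big_setU1 ?inE //= big_set1; lia.
Qed.

End Weight.

Section Path.
Variable n : nat.
Implicit Types (D : {set path_graph n}) (t u v w x s p : 'I_n).

Definition left_fib t x := if x < t then fib x.+1 else 0.
(** Mirror image of [left_fib]: [rev_ord] sends [x] to [n - x.+1], which turns [fib x.+1] into
    [fib (n - x)]. *)
Definition right_fib t x := if t < x then fib (n - x) else 0.

Definition left_heavy D t := fib t.+1 <= @weight (path_graph n) (left_fib t) D.
Definition right_heavy D t := fib (n - t) <= @weight (path_graph n) (right_fib t) D.

Definition light_empty t D :=
  [&& t \notin D, ~~ left_heavy D t & ~~ right_heavy D t].

Lemma jump_cases u v w : path_adj u v -> path_adj v w -> u != w ->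
  (v = u.+1 :> nat /\ w = u.+2 :> nat) \/ (v = w.+1 :> nat /\ u = w.+2 :> nat).
Proof. by rewrite /path_adj -(inj_eq val_inj) /=; lia. Qed.

(** A jump occupies three consecutive vertices, so it cannot straddle a vertex outside them. *)
Lemma jump_same_side t u v w : path_adj u v -> path_adj v w -> u != w ->
    u != t -> v != t -> w != t ->
  [/\ (u < t) = (w < t), (v < t) = (w < t), (t < u) = (t < w) & (t < v) = (t < w)].
Proof.
move=> uv vw uw; rewrite -!(inj_eq val_inj) /= => ut vt wt.
by case: (jump_cases uv vw uw) => -[E1 E2]; split; lia.
Qed.

Lemma left_fib_jump t u v w : path_adj u v -> path_adj v w -> u != w ->
    u != t -> v != t -> w != t ->
  left_fib t w <= left_fib t u + left_fib t v.
Proof.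
move=> uv vw uw ut vt wt; rewrite /left_fib.
have [-> -> _ _] := jump_same_side uv vw uw ut vt wt; case: ifP => // _.
case: (jump_cases uv vw uw) => -[-> ->]; first by rewrite fibSS.
by rewrite fibSS -addnA leq_addr.
Qed.

Lemma right_fib_jump t u v w : path_adj u v -> path_adj v w -> u != w ->
    u != t -> v != t -> w != t ->
  right_fib t w <= right_fib t u + right_fib t v.
Proof.
move=> uv vw uw ut vt wt; rewrite /right_fib.
have [_ _ -> ->] := jump_same_side uv vw uw ut vt wt; case: ifP => // _.
have ltu := ltn_ord u; have ltw := ltn_ord w.
case: (jump_cases uv vw uw) => -[Ev E].
  have -> : n - u = (n - w).+2 by lia.
  by rewrite fibSS -addnA leq_addr.
have -> : n - v = (n - u).+1 by lia.
by have -> : n - w = (n - u).+2 by lia.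
Qed.

(** Both pegs of a jump into [t] lie on the same side of [t], and by the recurrence their weights
    add up to the threshold of that side. *)
Lemma fib_jump_target t u v : path_adj u v -> path_adj v t -> u != t ->
  fib t.+1 <= left_fib t u + left_fib t v \/
  fib (n - t) <= right_fib t u + right_fib t v.
Proof.
move=> uv vt ut; have ltu := ltn_ord u; have ltt := ltn_ord t.
rewrite /left_fib /right_fib.
case: (jump_cases uv vt ut) => -[-> E]; [left | right]; rewrite E.
  by rewrite !ltnS leqnn leqnSn.
rewrite !ltnS leqnn leqnSn.
have -> : n - t.+1 = (n - t.+2).+1 by lia.
by have -> : n - t = (n - t.+2).+2 by lia.
Qed.

Lemma light_empty_move t D D' :
  pegging_move D D' -> light_empty t D -> light_empty t D'.
Proof.
case/existsP=> u /existsP[v /existsP[w]].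
case/and5P=> uD vD uv wD /andP[vw /eqP->].
have neq_uv : u != v by apply: contraTneq uv => ->; rewrite adj_irr.
have neq_uw : u != w by apply: contraNneq wD => <-.
have moveL := @weight_move (path_graph n) (left_fib t) _ _ _ _ uD vD neq_uv wD.
have moveR := @weight_move (path_graph n) (right_fib t) _ _ _ _ uD vD neq_uv wD.
case/and3P=> tD; rewrite /left_heavy /right_heavy -!ltnNge => ltL ltR.
have neq_ut : u != t by apply: contraNneq tD => <-.
have neq_vt : v != t by apply: contraNneq tD => <-.
have [Ew|neq_wt] := eqVneq w t.
  rewrite {}Ew in vw moveL moveR neq_uw.
  have cL0 : left_fib t t = 0 by rewrite /left_fib ltnn.
  have cR0 : right_fib t t = 0 by rewrite /right_fib ltnn.
  move: moveL moveR; rewrite cL0 cR0 !addn0 => EL ER.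
  (* The two pegs of a jump into [t] would already make [t] heavy in [D]. *)
  case: (fib_jump_target uv vw neq_uw) => le.
    by move: ltL; rewrite ltnNge (leq_trans le) // -EL leq_addl.
  by move: ltR; rewrite ltnNge (leq_trans le) // -ER leq_addl.
apply/and3P; split; first by rewrite !inE (negPf tD) andbF orbF eq_sym.
  rewrite /left_heavy -ltnNge; apply: leq_ltn_trans ltL.
  rewrite -(leq_add2r (left_fib t u + left_fib t v)) moveL leq_add2l.
  exact: left_fib_jump.
rewrite /right_heavy -ltnNge; apply: leq_ltn_trans ltR.
rewrite -(leq_add2r (right_fib t u + right_fib t v)) moveR leq_add2l.
exact: right_fib_jump.
Qed.

Lemma reach_heavy D t :
  t \in reach D -> t \notin D -> left_heavy D t || right_heavy D t.
Proof.
rewrite inE => /existsP[D' /andP[/connectP[p pathp ->] tD']] tD.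
apply: contraLR tD'; rewrite negb_or => light.
have {tD light} : light_empty t D by rewrite /light_empty tD.
elim: p D pathp => [|D1 p IHp] D /=; first by move=> _ /andP[].
by case/andP=> /light_empty_move mv /IHp{}IHp /mv /IHp.
Qed.

Lemma left_heavy_peg D t : left_heavy D t -> exists2 x, x \in D & x.+1 = t :> nat.
Proof.
move=> heavy; suff /exists_inP[x xD /eqP] : [exists x in D, x.+1 == t :> nat] by exists x.
apply: contraLR heavy => /exists_inPn noD; rewrite /left_heavy -ltnNge.
apply: leq_ltn_trans (sum_fib_lt n t); rewrite /weight big_mkcond [leqRHS]big_mkcond /=.
apply: leq_sum => x _; case: ifP => // /noD; rewrite /left_fib.
by do !case: ifP; lia.
Qed.

Lemma right_heavy_peg D t : right_heavy D t -> exists2 x, x \in D & x = t.+1 :> nat.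
Proof.
move=> heavy; suff /exists_inP[x xD /eqP] : [exists x in D, x == t.+1 :> nat] by exists x.
apply: contraLR heavy => /exists_inPn noD; rewrite /right_heavy -ltnNge.
(* [(n - t).-1] is the mirror image of [t], the cutoff that fits the sum once it is reindexed by
   [rev_ord]. *)
have ltt := ltn_ord t; have -> : n - t = (n - t).-1.+1 by lia.
apply: leq_ltn_trans (sum_fib_lt n _).
rewrite /weight (reindex_inj rev_ord_inj) big_mkcond [leqRHS]big_mkcond /=.
apply: leq_sum => x _; case: ifP => // /noD; rewrite /right_fib /=.
have ltx := ltn_ord x; have -> : n - (n - x.+1) = x.+1 by lia.
by do !case: ifP; lia.
Qed.

(** As [s] is empty, passing from [t] to [s] loses at most the peg at [p], and the threshold drops
    by exactly its weight: [fib t.+1 = fib s.+1 + fib p.+1]. *)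
Lemma left_heavy_step D t s p : left_heavy D t -> t = p.+1 :> nat ->
  p = s.+1 :> nat -> s \notin D -> left_heavy D s.
Proof.
rewrite /left_heavy => heavy Et Ep sD.
suff: @weight (path_graph n) (left_fib t) D
    <= @weight (path_graph n) (left_fib s) D + fib p.+1.
  by move: heavy; rewrite Et Ep (fibSS s.+1); lia.
have [pD|pD] := boolP (p \in D).
  rewrite /weight (bigD1 p) //= [in leqRHS](bigD1 p) //=.
  have -> : left_fib s p = 0 by rewrite /left_fib; case: ifP; lia.
  have -> : left_fib t p = fib p.+1 by rewrite /left_fib; case: ifP; lia.
  rewrite add0n addnC leq_add2r; apply: leq_sum => x /andP[xD].
  have : x != s by apply: contraNneq sD => <-.
  rewrite -!(inj_eq val_inj) /= /left_fib => *; case: ifP => //; case: ifP => //; lia.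
apply: leq_trans (leq_addr _ _); apply: leq_sum => x xD.
have : x != s by apply: contraNneq sD => <-.
have : x != p by apply: contraNneq pD => <-.
rewrite -!(inj_eq val_inj) /= /left_fib => *; case: ifP => //; case: ifP => //; lia.
Qed.

Lemma card_full_reach D : reach D = setT -> n <= #|D|.*2.
Proof.
move=> fullD.
have heavy t : t \in ~: D -> left_heavy D t || right_heavy D t.
  by rewrite inE; apply: reach_heavy; rewrite fullD inE.
(* The default [t] is never taken on an empty vertex, where heaviness supplies the peg. *)
pose f t : 'I_n :=
  odflt t (if left_heavy D t then [pick x in D | x.+1 == t :> nat]
           else [pick x in D | x == t.+1 :> nat]).
have fP t : t \in ~: D -> f t \in D /\
    if left_heavy D t then (f t).+1 = t :> nat else f t = t.+1 :> nat.
  move/heavy; rewrite /f; case: ifP => [/left_heavy_peg | _ /= /right_heavy_peg].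
    case=> x xD Ex; case: pickP => [y /andP[yD /eqP Ey] | /(_ x)] //=.
    by rewrite xD Ex eqxx.
  case=> x xD Ex; case: pickP => [y /andP[yD /eqP Ey] | /(_ x)] //=.
  by rewrite xD Ex eqxx.
have f_inj : {in ~: D &, injective f}.
  (* If [s] were not left-heavy, it would be the left neighbour of the common peg and [t] the right
     one, against [left_heavy_step]. *)
  have asym s t : s \in ~: D -> t \in ~: D -> f s = f t ->
      left_heavy D t -> left_heavy D s.
    move=> sD tD Efst Lt; apply: contraTT isT => NLs.
    have [_] := fP s sD; have [_] := fP t tD; rewrite Lt (negPf NLs) => Et Es.
    case/negP: NLs; apply: (@left_heavy_step _ t _ (f t)) => //; first by rewrite -Efst.
    by rewrite inE in sD.
  move=> s t sD tD Efst; apply: val_inj => /=.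
  have Lst : left_heavy D s = left_heavy D t.
    by apply/idP/idP; apply: asym.
  have [_] := fP s sD; have [_] := fP t tD; rewrite Lst Efst.
  by case: ifP => _; lia.
have leD : #|~: D| <= #|D|.
  rewrite -(card_in_imset f_inj); apply: subset_leq_card.
  by apply/subsetP=> _ /imsetP[t /fP[fD _] ->].
by have := cardsC D; rewrite card_ord; lia.
Qed.

(** The position after [k] jumps to the right: the travelling peg is at [k.*2.+1], and the even pegs
    beyond it are untouched. *)
Definition stairs k : {set path_graph n} :=
  [set x : 'I_n | (x == k.*2.+1 :> nat) || ~~ odd x && (k.*2.+2 <= x)].

Lemma stairs_move k : k.*2.+3 < n -> pegging_move (stairs k) (stairs k.+1).
Proof.
move=> ltkn.
have lt1 : k.*2.+1 < n by lia.
have lt2 : k.*2.+2 < n by lia.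
apply/existsP; exists (Ordinal lt1); apply/existsP; exists (Ordinal lt2).
apply/existsP; exists (Ordinal ltkn); rewrite !inE /= /adj /= /path_adj /=.
apply/and5P; split; try lia; apply/andP; split; first lia.
by apply/eqP/setP=> x; rewrite !inE -!(inj_eq val_inj) /=; lia.
Qed.

Lemma connect_stairs k : k.*2.+1 < n ->
  connect (@pegging_move (path_graph n)) (stairs 0) (stairs k).
Proof.
elim: k => [|k IHk] ltkn; first exact: connect0.
by apply: connect_trans (connect1 (stairs_move _)); [apply: IHk; lia | lia].
Qed.

Lemma reach_stairs : 3 <= n -> reach (stairs 0) = setT.
Proof.
move=> le3n; apply/setP=> x; rewrite [in RHS]inE.
have ltxn := ltn_ord x.
have [oddx|evenx] := boolP (odd x).
  rewrite inE; apply/existsP; exists (stairs x./2).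
  rewrite connect_stairs; last by lia.
  by rewrite inE; lia.
have [x0|xn0] := eqVneq (x : nat) 0; last first.
  by apply: (subsetP (sub_reach _)); rewrite inE; lia.
have lt1 : 1 < n by lia.
rewrite inE; apply/existsP.
(* [3 <= n] is also [2 < n], so [Ordinal le3n] is vertex 2, which jumps over 1 into 0. *)
exists (x |: (stairs 0 :\: [set (Ordinal le3n : path_graph n); Ordinal lt1])).
rewrite setU11 andbT; apply: connect1.
apply/existsP; exists (Ordinal le3n); apply/existsP; exists (Ordinal lt1).
by apply/existsP; exists x; rewrite !inE /= /adj /= /path_adj /= x0 /= eqxx.
Qed.

Lemma card_stairs : 3 <= n -> #|stairs 0| <= uphalf n.
Proof.
move=> le3n; have lt0 : 0 < uphalf n by lia.
(* Halving maps 1, 2, 4, 6, ... to 0, 1, 2, 3, ...; the default of [insubd] is never taken, since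
   [x < n] gives [x./2 < uphalf n]. *)
pose f x := insubd (Ordinal lt0) x./2.
suff f_inj : {in stairs 0 &, injective f}.
  by rewrite -(card_in_imset f_inj) -[leqRHS]card_ord max_card.
move=> x y; have ltx := ltn_ord x; have lty := ltn_ord y.
rewrite !inE => Sx Sy /(congr1 val); rewrite !val_insubd => Exy.
by apply: val_inj => /=; move: Exy; do !case: ifP; lia.
Qed.

End Path.

Theorem theorem3p5 (n : nat) (hn : 3 <= n) :
  optimal_pegging_number (path_graph n) = uphalf n.
Proof.
have [|] := @optimal_pegging_numberP (path_graph n); first by rewrite card_ord; lia.
case/andP=> _ /existsP[D /andP[/eqP cardD /eqP fullD]] min_opt.
apply/eqP; rewrite eqn_leq; apply/andP; split.
  apply: leq_trans (card_stairs hn); apply: min_opt; rewrite /full_reach_size.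
  apply/andP; split; last first.
    by apply/existsP; exists (stairs n 0); rewrite eqxx reach_stairs ?eqxx.
  have lt1 : 1 < n by lia.
  by apply/card_gt0P; exists (Ordinal lt1); rewrite inE.
by have := card_full_reach fullD; rewrite cardD; lia.
Qed.
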